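(* For any $m\in\mathbb{N}$ and any $\gamma\in(0,1)$ with $\gamma>1/\sqrt m$, there exist $0<\eta<\xi<1$, $c>0$, and $P^*\in\mathbb{N}$ such that the following holds. Fix any integer $p\ge P^*$ and any $\mathcal{I}\subset[0,\frac{\pi}{2}]$ (possibly depending on $n$) with $|\mathcal{I}|\le 2^{cn}$. Then $$\mathbb{P}\bigl[S(\gamma,m,\xi,\eta,\mathcal{I})\ne\varnothing\bigr]\le e^{-\Theta(n)}$$ as $n\to\infty$, where $S(\gamma,m,\xi,\eta,\mathcal{I})$ is the set of $m$-tuples of $\gamma$-optimal configurations for correlated pure $p$-spin Hamiltonians with pairwise overlaps in $[\xi-\eta,\xi]$.
   Context: For $n\in\mathbb{N}$, $\Sigma_n=\{-1,1\}^n$, and $\langle\boldsymbol{\sigma},\boldsymbol{\sigma}'\rangle=\sum_{i\le n}\boldsymbol{\sigma}_i\boldsymbol{\sigma}'_i$. Let $p\ge2$ be an integer, $m\in\mathbb{N}$, $0<\gamma<1$, $0<\eta<\xi<1$ and $\mathcal{I}\subset[0,\frac\pi2]$. Let $J^{(t)}_{i_1,\dots,i_p}$, $0\le t\le m$, $1\le i_1,\dots,i_p\le n$, be i.i.d. standard normal random variables and, for $1\le t\le m$ and $\tau\in[0,\frac\pi2]$, let $$\widehat{J}^{(t)}_{i_1,\dots,i_p}(\tau)=\cos(\tau)J^{(0)}_{i_1,\dots,i_p}+\sin(\tau)J^{(t)}_{i_1,\dots,i_p}.$$ $S(\gamma,m,\xi,\eta,\mathcal{I})$ denotes the (random) set of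 all $m$-tuples $(\boldsymbol{\sigma}^{(1)},\dots,\boldsymbol{\sigma}^{(m)})$, $\boldsymbol{\sigma}^{(t)}\in\Sigma_n$, satisfying: ($\gamma$-optimality) there exist $\tau_1,\dots,\tau_m\in\mathcal{I}$ such that $$n^{-\frac{p+1}{2}}\sum_{1\le i_1,\dots,i_p\le n}\widehat{J}^{(t)}_{i_1,\dots,i_p}(\tau_t)\,\boldsymbol{\sigma}^{(t)}_{i_1}\cdots\boldsymbol{\sigma}^{(t)}_{i_p}\ge\gamma\sqrt{2\ln2},\qquad\forall\,1\le t\le m;$$ (overlap constraint) for any $1\le t<\ell\le m$, $n^{-1}\langle\boldsymbol{\sigma}^{(t)},\boldsymbol{\sigma}^{(\ell)}\rangle\in[\xi-\eta,\xi]$. The bound ''$\le e^{-\Theta(n)}$ as $n\to\infty$'' means: there is a constant $C>0$ not depending on $n$ such that the quantity is at most $e^{-Cn}$ for all large $n$. *)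

(* Defs.v *)
From HB Require Import structures.
From mathcomp Require Import all_boot all_order all_algebra finmap.
From mathcomp Require Import all_classical all_reals all_analysis.

Set Implicit Arguments.
Unset Strict Implicit.
Unset Printing Implicit Defensive.

Import Order.TTheory GRing.Theory Num.Theory.
Import numFieldNormedType.Exports.

Local Open Scope classical_set_scope.
Local Open Scope ring_scope.

Section Spins.
Variables (R : realType) (n : nat).

Definition Sigma : set 'rV[R]_n :=
  [set s | forall i, s 0 i = -1 \/ s 0 i = 1].

Definition inner (s s' : 'rV[R]_n) : R := \sum_(i < n) s 0 i * s' 0 i.

End Spins.

Section IID.
Variables (R : realType) (d : measure_display) (T : measurableType d).
Variables (P : probability T R) (K : finType) (X : K -> {RV P >-> R}).

Definition mutually_independent : Prop :=
  forall (F : {set K}) (A : K -> set R), (forall k, measurable (A k)) ->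
    P (\bigcap_(k in [set` F]) (X k @^-1` A k)) =
    (\prod_(k in F) P (X k @^-1` A k))%E.

(* The two laws are compared on Borel sets only: as Rocq functions both are
   also defined, with junk values, on nonmeasurable sets. *)
Definition iid_std_normal : Prop :=
  mutually_independent /\
  forall k (A : set R), measurable A ->
    distribution P (X k) A = normal_prob 0 1 A.

End IID.

Section PSpin.
Variables (R : realType) (p n m : nat).

(* An index (t, (i_1, ..., i_p)) of a disorder variable, 0 <= t <= m. *)
Definition disorder_index : finType := ('I_m.+1 * {ffun 'I_p -> 'I_n})%type.

Variables (d : measure_display) (T : measurableType d) (P : probability T R).
Variable J : disorder_index -> {RV P >-> R}.

(* The t-th replica, 1 <= t <= m, is encoded by t : 'I_m and uses the disorder
   array of index lift ord0 t, whose value is t.+1. *)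
Definition Jhat (t : 'I_m) (tau : R) (i : {ffun 'I_p -> 'I_n}) (w : T) : R :=
  cos tau * J (ord0, i) w + sin tau * J (lift ord0 t, i) w.

Definition hamiltonian (t : 'I_m) (tau : R) (s : 'rV[R]_n) (w : T) : R :=
  n%:R `^ (- (p.+1%:R / 2)) *
    \sum_(i : {ffun 'I_p -> 'I_n}) Jhat t tau i w * \prod_(k < p) s 0 (i k).

Definition Sset (gamma xi eta : R) (I : set R) (w : T) :
    set ('I_m -> 'rV[R]_n) :=
  [set s | [/\ forall t, Sigma (s t),
     exists tau : 'I_m -> R, (forall t, I (tau t)) /\
       forall t, gamma * Num.sqrt (2 * ln 2) <= hamiltonian t (tau t) (s t) w
   & forall t l : 'I_m, (t < l)%N ->
       xi - eta <= n%:R^-1 * inner (s t) (s l) <= xi]].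

End PSpin.

(* Main.v *)
Require Import Defs.
From HB Require Import structures.
From mathcomp Require Import all_boot all_order all_algebra finmap.
From mathcomp Require Import all_classical all_reals all_analysis.
From mathcomp Require Import measurable_realfun.
From mathcomp Require Import ring lra.
Import Order.TTheory GRing.Theory Num.Theory.
Import numFieldNormedType.Exports.
Local Open Scope classical_set_scope.
Local Open Scope ring_scope.

(** The proof is a first-moment argument, with the overlap window placed close
    to 1: [xi = 1 - delta] and [eta = delta] for a small [delta].

    Fix spins [s] and angles [tau].  If all [m] replicas are gamma-optimal, so
    is their average, hence the sum over [t] of the Hamiltonians is at least
    [m * gamma * sqrt (2 ln 2)].  This sum is a linear combination of the i.i.d.
    normal disorder variables.  Up to normalisation its variance is a double sum
    over pairs of replicas: each diagonal pair contributes 1 since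
    [cos ^ 2 + sin ^ 2 = 1], and an off-diagonal pair at most the [p]-th power of
    its overlap, which lies between 0 and [xi]
    ([sum_hamiltonian_coef_sqr_le]).  As [xi < 1],
    for large [p] the replicas are almost independent, and a Chernoff bound
    ([gaussian_sum_tail], [hamiltonian_tuple_tail]) gives a probability at most
    [2 ^ (- n * m * gamma ^ 2 / (1 + m * xi ^ p))].

    On the other side, admissible tuples are few: all the spins of a tuple lie
    in a small Hamming cap around the first one, so that there are at most
    [2 ^ n * exp (kappa * m * n)] of them with [kappa] arbitrarily small when
    [delta] is ([card_tuples_le]), and at most [2 ^ (c * m * n)] choices of
    angles.  Since [m * gamma ^ 2 > 1], the parameters can be chosen so that the
    tail beats the entropy [2 ^ n] ([parameters_exist]).

    The Chernoff bound needs the moment generating function of a sum of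
    independent variables.  The factorisation of expectations
    ([expectation_prod_independent]) is derived from the product rule on events
    by replacing indicators with nonnegative functions, one variable at a time;
    each replacement is an instance of [ge0_integral_image_density], which also
    yields the Gaussian integral [integral_expR_normal]. *)

(** * Integration against an image measure with density *)

Section ImageMeasure.
Import HBNNSimple.
Local Open Scope ereal_scope.

(** If [c * nu] is the image under [phi] of the measure with density [h] with
    respect to [mu], the change of variables formula holds for nonnegative
    functions. *)
Lemma ge0_integral_image_density (R : realType) (d1 d2 : measure_display)
    (X : measurableType d1) (Y : measurableType d2)
    (mu : {measure set X -> \bar R}) (nu : {measure set Y -> \bar R})
    (phi : X -> Y) (h : X -> R) (c : R) (f : Y -> R) :
  measurable_fun setT phi -> measurable_fun setT h ->
  (forall x, 0 <= h x)%R -> (0 <= c)%R ->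
  (forall A, measurable A -> c%:E * nu A = \int[mu]_x (\1_A (phi x) * h x)%:E) ->
  measurable_fun setT f -> (forall y, 0 <= f y)%R ->
  c%:E * \int[nu]_y (f y)%:E = \int[mu]_x (f (phi x) * h x)%:E.
Proof.
move=> mphi mh h0 c0 nuE mf f0.
have mf' : measurable_fun setT (EFin \o f : Y -> \bar R) by exact/measurable_EFinP.
pose f_ := nnsfun_approx measurableT mf'.
have f_f y : (f_ n y)%:E @[n --> \oo] --> (f y)%:E.
  by apply: cvg_nnsfun_approx => // x _; rewrite lee_fin.
have nd x : nondecreasing_seq (fun n => f_ n x).
  by move=> m n mn; exact/lefP/nd_nnsfun_approx.
(* the identity for simple functions, by linearity *)
have simple n : c%:E * \int[nu]_y (f_ n y)%:E
    = \int[mu]_x (f_ n (phi x) * h x)%:E.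
  rewrite integralT_nnsfun sintegralE ge0_mule_fsumr; last first.
    move=> r; have [r0|r0] := leP 0%R r; first by rewrite mule_ge0.
    rewrite preimage_nnfun0// measure0 mule0//.
  have E x : (f_ n (phi x) * h x)%:E = \sum_(r \in range (f_ n))
      (r * (\1_(f_ n @^-1` [set r]) (phi x) * h x))%:E.
    rewrite {1}fimfunE mulr_fsuml ?fsumEFin//.
    by congr _%:E; apply: eq_fsbigr => r _; rewrite mulrA.
  under [RHS]eq_integral do rewrite E.
  have mi r : measurable_fun setT
      (fun x : X => \1_(f_ n @^-1` [set r]) (phi x) * h x : R)%R.
    apply: measurable_funM => //.
    have m1 : measurable_fun setT (\1_(f_ n @^-1` [set r]) : Y -> R).
      exact: measurable_indic.
    exact: (measurableT_comp m1 mphi).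
  rewrite ge0_integral_fsum//; first last.
  - move=> r x _; rewrite lee_fin mulrA mulr_ge0//.
    by rewrite -lee_fin nnfun_muleindic_ge0.
  - by move=> r; apply/measurable_EFinP/measurable_funM => //; exact: mi.
  apply: eq_fsbigr => r; rewrite inE => -[y _ yr].
  have r0 : (0 <= r)%R by rewrite -yr.
  under [RHS]eq_integral do rewrite EFinM.
  rewrite ge0_integralZl//; last 2 first.
  - exact/measurable_EFinP/mi.
  - by move=> x _; rewrite lee_fin mulr_ge0.
  by rewrite -nuE// muleCA.
have cvgl : c%:E * \int[nu]_y (f_ n y)%:E @[n --> \oo] --> c%:E * \int[nu]_y (f y)%:E.
  apply: cvgeZl => //.
  have -> : \int[nu]_y (f y)%:E = \int[nu]_y limn (fun n => (f_ n y)%:E).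
    by apply: eq_integral => y _; apply/esym/cvg_lim => //; exact: f_f.
  apply: cvg_monotone_convergence => //.
  - by move=> n; exact/measurable_EFinP.
  - by move=> n x _; rewrite lee_fin.
  - by move=> x _ m n mn; rewrite lee_fin; exact: nd.
have cvgr : c%:E * \int[nu]_y (f_ n y)%:E @[n --> \oo]
    --> \int[mu]_x (f (phi x) * h x)%:E.
  under eq_fun do rewrite simple.
  have -> : \int[mu]_x (f (phi x) * h x)%:E
      = \int[mu]_x limn (fun n => (f_ n (phi x) * h x)%:E).
    apply: eq_integral => x _; apply/esym/cvg_lim => //.
    by under eq_fun do rewrite EFinM; rewrite EFinM; apply: cvgeZr => //; exact: f_f.
  apply: cvg_monotone_convergence => //.
  - move=> n; apply/measurable_EFinP/measurable_funM => //.
    exact: measurableT_comp.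
  - by move=> n x _; rewrite lee_fin mulr_ge0.
  - by move=> x _ m n mn; rewrite lee_fin ler_wpM2r//; exact: nd.
exact: (cvg_unique _ cvgl cvgr).
Qed.

End ImageMeasure.

(** * Expectation of a product of independent variables *)

Section Independence.
Local Open Scope ereal_scope.

Lemma expectation_prod_independent (R : realType) (d : measure_display)
    (T : measurableType d) (P : probability T R) (K : finType)
    (X : K -> {RV P >-> R}) (f : K -> R -> R) (c : K -> R) :
  mutually_independent X ->
  (forall k, measurable_fun setT (f k)) -> (forall k x, 0 <= f k x)%R ->
  (forall k, \int[P]_w (f k (X k w))%:E = (c k)%:E) ->
  \int[P]_w (\prod_k f k (X k w))%:E = (\prod_k c k)%:E.
Proof.
move=> indX.
(* Induction on the list [s] of the variables that may carry a general
   function; the others carry indicators. *)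
suff: forall (s : seq K) (f : K -> R -> R) (c : K -> R),
    (forall k, k \notin s ->
       exists2 A : set R, measurable A & f k = \1_A) ->
    (forall k, measurable_fun setT (f k)) -> (forall k x, 0 <= f k x)%R ->
    (forall k, \int[P]_w (f k (X k w))%:E = (c k)%:E) ->
    \int[P]_w (\prod_k f k (X k w))%:E = (\prod_k c k)%:E.
  by move=> /(_ (enum K)) H; apply: H => k; rewrite mem_enum.
elim => [|a s IH] {}f {}c fA mf f0 fc.
  have /choice[A AP] : forall k, exists A : set R, measurable A /\ f k = \1_A.
    by move=> k; have [//|A mA fkA] := fA k; exists A.
  have mXA k : measurable (X k @^-1` A k).
    by rewrite -[X in measurable X]setTI; apply: measurable_funP => //; exact: (AP k).1.
  have cE k : P (X k @^-1` A k) = (c k)%:E.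
    by rewrite -[Y in P Y]setIT -integral_indic// -fc (AP k).2.
  transitivity (P (\bigcap_(k in [set` [set: K]%SET]) (X k @^-1` A k))).
    rewrite -[X in P X]setIT -integral_indic//; last first.
      by apply: fin_bigcap_measurable.
    apply: eq_integral => w _; congr _%:E.
    rewrite indicE; have [wA|] := boolP (_ \in _).
      rewrite big1// => k _; rewrite (AP k).2 indicE mem_set//.
      by move: wA; rewrite inE => /(_ k); apply; rewrite /= inE.
    move=> /negP wA; apply/eqP/prodf_eq0.
    have : ~ (forall k, A k (X k w)).
      by apply: contra_not wA => wA; rewrite inE => k _; exact: wA.
    move=> /existsNP[k kA]; exists k => //.
    by rewrite (AP k).2 indicE memNset.
  rewrite indX; last by move=> k; exact: (AP k).1.
  rewrite (eq_bigr (fun k => (c k)%:E)) // prodEFin.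
  by under eq_bigl do rewrite inE.
(* The image under [X a] of the measure of density [h] is [e] times the law of
   [X a]: this is the induction hypothesis with an indicator in place of [f a]. *)
pose h w : R := (\prod_(k | k != a) f k (X k w))%R.
pose e := (\prod_(k | k != a) c k)%R.
have c0 k : (0 <= c k)%R.
  by rewrite -lee_fin -fc; apply: integral_ge0 => w _; rewrite lee_fin.
have mfX k : measurable_fun setT (fun w => f k (X k w)).
  by apply: measurableT_comp => //.
have -> : (\prod_k c k)%:E = e%:E * \int[distribution P (X a)]_y (f a y)%:E.
  rewrite ge0_integral_distribution//; last 2 first.
  - exact/measurable_EFinP.
  - by move=> y; rewrite lee_fin.
  by rewrite /= fc -EFinM (bigD1 a)//= mulrC.
under eq_integral do rewrite (bigD1 a)//=.
apply/esym; apply: (@ge0_integral_image_density _ _ _ _ _ P _ (X a) h) => //.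
- rewrite /h; under eq_fun do rewrite -big_filter.
  by apply: measurable_prod => k _; exact: mfX.
- by move=> w; exact: prodr_ge0.
- exact: prodr_ge0.
move=> A mA.
pose g k := if k == a then \1_A else f k.
pose q k := if k == a then fine (distribution P (X a) A) else c k.
transitivity (\int[P]_w (\prod_k g k (X k w))%:E); last first.
  apply: eq_integral => w _; rewrite (bigD1 a)//= /g eqxx.
  by congr (_ * _)%:E; apply: eq_bigr => k /negbTE ->.
rewrite (IH g q).
- rewrite (bigD1 a)//= /q eqxx EFinM fineK ?fin_num_measure// muleC.
  by congr (_ * _%:E); apply: eq_bigr => k /negbTE ->.
- move=> k ks; rewrite /g; case: eqVneq => [_|ka]; first by exists A.
  by apply: fA; rewrite inE negb_or ka.
- by move=> k; rewrite /g; case: ifP => // _; exact: measurable_indic.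
- by move=> k x; rewrite /g; case: ifP.
- move=> k; rewrite /g /q; case: eqVneq => [->|] //.
  rewrite fineK ?fin_num_measure//.
  rewrite -[A in distribution _ _ A]setIT -integral_indic// ge0_integral_distribution//.
  exact/measurable_EFinP/measurable_indic.
Qed.

End Independence.

(** * Tail of a linear combination of normal variables *)

Section Gaussian.
Local Open Scope ereal_scope.

(** Completing the square: tilting the standard normal density by
    [expR (a * x)] gives [expR (a ^+ 2 / 2)] times the density of mean [a].  The
    measure [nu] is assumed to agree with the normal law on Borel sets only. *)
Lemma integral_expR_normal (R : realType) (nu : {measure set R -> \bar R})
    (a : R) :
  (forall A, measurable A -> nu A = normal_prob 0 1 A) ->
  \int[nu]_x (expR (a * x))%:E = (expR (a ^+ 2 / 2))%:E.
Proof.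
move=> nuE.
have o0 : (1 != 0 :> R)%R by [].
have mexp : measurable_fun setT (fun x : R => expR (a * x)%R).
  by apply: measurableT_comp => //; exact: measurable_funM.
rewrite -[LHS]mul1e (@ge0_integral_image_density _ _ _ _ _ lebesgue_measure nu
  idfun (normal_pdf 0 1) 1)//; first last.
- move=> A mA; rewrite mul1e nuE// /normal_prob [LHS]integral_mkcond.
  apply: eq_integral => x _; rewrite patchE indicE /=.
  by case: ifP; rewrite ?mul1r ?mul0r.
- by move=> x; exact: normal_pdf_ge0.
- exact: measurable_normal_pdf.
- exact: measurable_id.
transitivity (\int[lebesgue_measure]_x
    ((expR (a ^+ 2 / 2))%:E * (normal_pdf a 1 x)%:E)).
  apply: eq_integral => x _; rewrite -EFinM !normal_pdfE//; congr _%:E => /=.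
  rewrite mulrCA [RHS]mulrCA; congr (_ * _)%R.
  rewrite /normal_fun -!expRD; congr expR.
  by field.
rewrite ge0_integralZl//.
- by rewrite integral_normal_pdf ?mule1.
- by apply/measurable_EFinP; exact: measurable_normal_pdf.
- by move=> x _; rewrite lee_fin normal_pdf_ge0.
Qed.

Lemma measurable_weighted_sum_ge (R : realType) (d : measure_display)
    (T : measurableType d) (P : probability T R) (K : finType)
    (X : K -> {RV P >-> R}) (a : K -> R) (b : R) :
  measurable [set w | b <= \sum_k a k * X k w]%R.
Proof.
rewrite [Y in measurable Y](_ : _ =
    [set: T] `&` (fun w => \sum_k a k * X k w)%R @^-1` `[b, +oo[).
  have mS : measurable_fun setT (fun w => \sum_k a k * X k w)%R.
    by apply: measurable_sum => k; apply: measurable_funM.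
  exact: mS.
by rewrite setTI; apply/seteqP; split => w /=; rewrite in_itv/= andbT.
Qed.

(** Chernoff bound, with the parameter [b / v], which is optimal when [v] is the
    variance. *)
Lemma gaussian_sum_tail (R : realType) (d : measure_display)
    (T : measurableType d) (P : probability T R) (K : finType)
    (X : K -> {RV P >-> R}) (a : K -> R) (v b : R) :
  iid_std_normal X -> (0 < v)%R -> (\sum_k a k ^+ 2 <= v)%R -> (0 < b)%R ->
  P [set w | b <= \sum_k a k * X k w]%R <= (expR (- (b ^+ 2 / (2 * v))))%:E.
Proof.
move=> [indX normX] v0 av b0.
pose l : R := (b / v)%R.
have l0 : (0 < l)%R by rewrite divr_gt0.
pose S w : R := (\sum_k a k * X k w)%R.
have mS : measurable_fun setT S.
  by apply: measurable_sum => k; apply: measurable_funM.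
have mexp e : measurable_fun setT (fun x : R => expR (e * x)%R).
  by apply: measurableT_comp => //; exact: measurable_funM.
have mgf : \int[P]_w (expR (l * S w))%:E
    = (expR (l ^+ 2 / 2 * \sum_k a k ^+ 2))%:E.
  have -> : expR (l ^+ 2 / 2 * \sum_k a k ^+ 2)%R
      = (\prod_k expR ((l * a k) ^+ 2 / 2))%R.
    rewrite -expR_sum; congr expR; rewrite mulr_sumr; apply: eq_bigr => k _.
    by field.
  rewrite -(@expectation_prod_independent _ _ _ P _ X
    (fun k x => expR (l * a k * x)%R))//; first last.
  - move=> k; rewrite -(integral_expR_normal _ _ (l * a k) (normX k)).
    rewrite ge0_integral_distribution//.
    by apply/measurable_EFinP; exact: mexp.
  apply: eq_integral => w _; rewrite -expR_sum; congr (expR _)%:E.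
  by rewrite mulr_sumr; apply: eq_bigr => k _; rewrite mulrA.
have mexpS : measurable_fun setT (fun w => expR (l * S w)%R).
  by apply: measurableT_comp => //; exact: measurable_funM.
have mB : measurable [set w | b <= S w]%R.
  exact: measurable_weighted_sum_ge.
pose B := [set w | (b <= S w)%R].
have markov : (expR (l * b))%:E * P B
    <= \int[P]_w (expR (l * S w))%:E.
  rewrite -[B]setIT -integral_indic// -ge0_integralZl//; last first.
    exact/measurable_EFinP/measurable_indic.
  apply: ge0_le_integral => //.
  - by apply: measurable_funeM; exact/measurable_EFinP/measurable_indic.
  - exact/measurable_EFinP.
  move=> w _; rewrite -EFinM lee_fin indicE.
  have [|] := boolP (w \in B); last by rewrite mulr0 expR_ge0.
  by rewrite inE /B /= => bS; rewrite mulr1 ler_expR ler_pM2l.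
have PB : P B = (fine (P B))%:E by rewrite fineK// fin_num_measure.
rewrite -[X in P X]/B PB lee_fin.
move: markov; rewrite mgf PB -EFinM lee_fin mulrC -ler_pdivlMr ?expR_gt0//.
move=> /le_trans; apply; rewrite -expRN -expRD ler_expR.
apply: (@le_trans _ _ (l ^+ 2 / 2 * v - l * b)%R).
  by rewrite lerD2r ler_wpM2l// divr_ge0// sqr_ge0.
rewrite le_eqVlt; apply/orP; left; apply/eqP; rewrite /l.
by field; rewrite gt_eqF.
Qed.

End Gaussian.

(** * Counting spin tuples with large overlaps *)

Section Spins.
Variables (R : realType) (n : nat).
Implicit Types (s t : 'rV[R]_n) (e : {ffun 'I_n -> bool}).

(** The sign vector encoded by [e], with [true] standing for [-1]. *)
Definition spin e : 'rV[R]_n := \row_i (-1) ^+ e i.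

Lemma Sigma_spin e : Sigma (spin e).
Proof. by move=> i; rewrite mxE; case: (e i); [left|right]; rewrite ?expr1. Qed.

Lemma SigmaP s : Sigma s -> exists e, s = spin e.
Proof.
move=> sS; exists [ffun i => s 0 i == -1]; apply/rowP => i; rewrite mxE ffunE.
have [->|->] := sS i; first by rewrite eqxx.
by rewrite eq_sym eqNr oner_eq0.
Qed.

Lemma inner_self s : Sigma s -> inner s s = n%:R.
Proof.
move=> sS; rewrite /inner (eq_bigr (fun=> 1)); last first.
  by move=> i _; have [->|->] := sS i; rewrite ?mulrNN mulr1.
by rewrite sumr_const card_ord.
Qed.

(** The [p]-fold tensor powers of [s] and [t] have inner product
    [inner s t ^+ p]. *)
Lemma sum_prod_inner (p : nat) s t :
  \sum_(i : {ffun 'I_p -> 'I_n}) (\prod_(k < p) s 0 (i k)) * (\prod_(k < p) t 0 (i k))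
  = inner s t ^+ p.
Proof.
under eq_bigr do rewrite -big_split/=.
by rewrite -(bigA_distr_bigA (fun (_ : 'I_p) j => s 0 j * t 0 j)) prodr_const card_ord.
Qed.

(** Exponential Markov bound on the size of a Hamming cap: the total weight
    [\sum_e expR (l * inner (spin e0) (spin e))] is
    [(expR l + expR (- l)) ^+ n]. *)
Lemma card_cap_le e0 (l delta : R) : 0 < l ->
  #|[set e | (1 - 2 * delta) * n%:R <= inner (spin e0) (spin e)]%SET|%:R
    <= expR (n%:R * (expR (- (2 * l)) + 2 * l * delta)) :> R.
Proof.
move=> l0; set A := [set e | _]%SET.
have total : \sum_e expR (l * inner (spin e0) (spin e))
    = (expR l + expR (- l)) ^+ n.
  under eq_bigr do rewrite /inner mulr_sumr expR_sum.
  pose F (i : 'I_n) (b : bool) : R := expR (l * ((-1) ^+ e0 i * (-1) ^+ b)).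
  transitivity (\sum_(e : {ffun 'I_n -> bool}) \prod_i F i (e i)).
    by apply: eq_bigr => e _; apply: eq_bigr => i _; rewrite !mxE.
  rewrite -bigA_distr_bigA /= (eq_bigr (fun=> expR l + expR (- l))).
    by rewrite prodr_const card_ord.
  move=> i _; rewrite big_bool /F; case: (e0 i); rewrite /= ?expr1 ?expr0.
    by rewrite mulrNN !mulr1 mulrN1.
  by rewrite !mul1r mulrN1 mulr1 addrC.
have cosh_le : expR l + expR (- l) <= expR (l + expR (- (2 * l))).
  have -> : - l = l + - (2 * l) by ring.
  rewrite !expRD -{1}[expR l]mulr1 -mulrDr ler_wpM2l ?expR_ge0//.
  exact: expR_ge1Dx.
apply: (@le_trans _ _ (\sum_e
    expR (l * inner (spin e0) (spin e) - l * ((1 - 2 * delta) * n%:R)))).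
  rewrite -sum1_card natr_sum big_mkcond /=; apply: ler_sum => e _.
  case: ifP => [|_]; last exact: expR_ge0.
  rewrite inE => eA; rewrite -[leLHS]expR0 ler_expR subr_ge0.
  by rewrite ler_pM2l.
under eq_bigr do rewrite expRD.
rewrite -mulr_suml total.
apply: (@le_trans _ _ (expR (l + expR (- (2 * l))) ^+ n
    * expR (- (l * ((1 - 2 * delta) * n%:R))))).
  rewrite ler_wpM2r ?expR_ge0// lerXn2r ?nnegrE ?addr_ge0 ?expR_ge0//.
rewrite -expRM_natl -expRD ler_expR le_eqVlt; apply/orP; left; apply/eqP.
by ring.
Qed.

End Spins.
Arguments spin R {n} e.

Lemma card_tuples_le (R : realType) (n m : nat) (l delta : R) : (0 < m)%N ->
  0 < l -> 0 <= delta ->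
  #|[set s : {ffun 'I_m -> {ffun 'I_n -> bool}} | [forall t : 'I_m, forall u : 'I_m,
      (t < u)%N ==> ((1 - 2 * delta) * n%:R <=
        inner (spin R (s t)) (spin R (s u)))]]%SET|%:R
    <= 2 ^+ n * expR (n%:R * (expR (- (2 * l)) + 2 * l * delta)) ^+ m :> R.
Proof.
move=> m0 l0 d0; set A := [set s | _]%SET.
pose cap e0 : {set {ffun 'I_n -> bool}} :=
  [set e | (1 - 2 * delta) * n%:R <= inner (spin R e0) (spin R e)]%SET.
(* a tuple lies in the product of caps around its own first element *)
have subA : A \subset \big[@finset.setU _/finset.set0]_(e0 : {ffun 'I_n -> bool})
    [set s : {ffun 'I_m -> {ffun 'I_n -> bool}} | [forall t, s t \in cap e0]]%SET.
  apply/fintype.subsetP => s; rewrite inE => /forallP sA.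
  apply/finset.bigcupP; exists (s (Ordinal m0)) => //; rewrite inE.
  apply/forallP => t; rewrite inE.
  have [t0|t0] := posnP t.
    have -> : t = Ordinal m0 by exact: val_inj.
    rewrite inner_self; last exact: Sigma_spin.
    by rewrite ler_piMl// lerBlDr lerDl mulr_ge0.
  by have /forallP/(_ t)/implyP := sA (Ordinal m0); apply.
have cardA : (#|A| <= \sum_(e0 : {ffun 'I_n -> bool}) #|cap e0| ^ m)%N.
  apply: (leq_trans (fintype.subset_leq_card subA)).
  apply: (@big_ind2 _ _ (fun (B : {set _}) k => (#|B| <= k)%N)).
  - by rewrite finset.cards0.
  - move=> B b B' b' Bb Bb'.
    exact: (leq_trans (leq_card_setU _ _) (leq_add Bb Bb')).
  move=> e0 _.
  rewrite -[X in (_ ^ X)%N]card_ord -card_ffun_on; apply: fintype.subset_leq_card.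
  by apply/fintype.subsetP => s; rewrite inE => /forallP sA; apply/ffun_onP.
apply: (@le_trans _ _ (\sum_(e0 : {ffun 'I_n -> bool}) #|cap e0|%:R ^+ m)).
  move: cardA; rewrite -(ler_nat R) => /le_trans; apply.
  by rewrite natr_sum; under eq_bigr do rewrite natrX.
apply: (@le_trans _ _ (\sum_(e0 : {ffun 'I_n -> bool})
    expR (n%:R * (expR (- (2 * l)) + 2 * l * delta)) ^+ m)).
  apply: ler_sum => e0 _; apply: lerXn2r; rewrite ?nnegrE ?expR_ge0//.
  exact: card_cap_le.
by rewrite sumr_const card_ffun card_bool card_ord -[leLHS]mulr_natl natrX.
Qed.

(** * Variance and tail of the sum of the Hamiltonians *)

Section Covariance.
Variables (R : realType) (p n m : nat).
Implicit Types (s : 'I_m -> 'rV[R]_n) (tau : 'I_m -> R).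

(** The weight of the [j]-th disorder array in the [t]-th correlated array:
    [cos] for the common array 0, [sin] for the array proper to replica [t], and
    0 for the others. *)
Definition disorder_weight tau (t : 'I_m) (j : 'I_m.+1) : R :=
  if unlift ord0 j is Some l then (l == t)%:R * sin (tau t) else cos (tau t).

(** The coefficient of the disorder variable [k] in the sum over all replicas of
    the unnormalised Hamiltonians. *)
Definition hamiltonian_coef s tau (k : disorder_index p n m) : R :=
  \sum_t disorder_weight tau t k.1 * \prod_(i < p) s t 0 (k.2 i).

Lemma sum_hamiltonianE (d : measure_display) (T : measurableType d)
    (P : probability T R) (J : disorder_index p n m -> {RV P >-> R}) s tau w :
  \sum_t hamiltonian J t (tau t) (s t) w =
  n%:R `^ (- (p.+1%:R / 2)) * \sum_k hamiltonian_coef s tau k * J k w.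
Proof.
rewrite /hamiltonian -mulr_sumr; congr (_ * _).
rewrite /hamiltonian_coef.
under [RHS]eq_bigr do rewrite mulr_suml.
rewrite [RHS]exchange_big /=; apply: eq_bigr => t _.
transitivity (\sum_j \sum_(i : {ffun 'I_p -> 'I_n})
    disorder_weight tau t j * \prod_(k < p) s t 0 (i k) * J (j, i) w); last first.
  by rewrite pair_bigA /=; apply: eq_bigr => -[].
rewrite exchange_big /=.
apply: eq_bigr => i _.
rewrite big_ord_recl /disorder_weight unlift_none (bigD1 t)//= liftK eqxx.
rewrite [X in _ + (_ + X)]big1 ?addr0; last first.
  by move=> l /negbTE lt; rewrite liftK lt !mul0r.
by rewrite /Jhat /=; ring.
Qed.

Lemma sum_disorder_weight tau t l :
  \sum_j disorder_weight tau t j * disorder_weight tau l j =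
  cos (tau t) * cos (tau l) + (t == l)%:R * sin (tau t) ^+ 2.
Proof.
rewrite big_ord_recl /disorder_weight unlift_none; congr (_ + _).
rewrite (bigD1 t)//= liftK eqxx big1 ?addr0; last first.
  by move=> k /negbTE kt; rewrite liftK kt !mul0r.
by case: eqVneq => /= [->|_]; [ring|rewrite !mul0r mulr0].
Qed.

Lemma sum_hamiltonian_coef_sqr s tau :
  \sum_k hamiltonian_coef s tau k ^+ 2 =
  \sum_t \sum_l (cos (tau t) * cos (tau l) + (t == l)%:R * sin (tau t) ^+ 2)
     * inner (s t) (s l) ^+ p.
Proof.
under eq_bigr do rewrite expr2 /hamiltonian_coef big_distrlr /=.
rewrite exchange_big /=; apply: eq_bigr => t _.
rewrite exchange_big /=; apply: eq_bigr => l _.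
rewrite -sum_disorder_weight -sum_prod_inner big_distrlr /=.
rewrite pair_bigA /=; apply: eq_bigr => -[j i] _ /=.
by rewrite mulrACA.
Qed.

Lemma sum_hamiltonian_coef_sqr_le s tau (r : R) :
  (forall t, Sigma (s t)) -> 
  (forall t l, t != l -> 0 <= inner (s t) (s l) <= r) -> 0 <= r ->
  \sum_k hamiltonian_coef s tau k ^+ 2 <= m%:R * n%:R ^+ p + m%:R ^+ 2 * r ^+ p.
Proof.
move=> sS sr r0; rewrite sum_hamiltonian_coef_sqr.
apply: (@le_trans _ _ (\sum_(t < m) \sum_(l < m)
    ((t == l)%:R * n%:R ^+ p + r ^+ p))).
  apply: ler_sum => t _; apply: ler_sum => l _.
  have [<-|tl] := eqVneq t l.
    by rewrite !mul1r -expr2 cos2Dsin2 mul1r inner_self// lerDl exprn_ge0.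
  rewrite !mul0r addr0 add0r; have /andP[i0 ir] := sr _ _ tl.
  apply: (@le_trans _ _ (inner (s t) (s l) ^+ p)); last exact: lerXn2r.
  have cc : cos (tau t) * cos (tau l) <= 1.
    rewrite (le_trans (ler_norm _))// normrM mulr_ile1//.
    - by rewrite ler_norml cos_geN1 cos_le1.
    - by rewrite ler_norml cos_geN1 cos_le1.
  by rewrite ler_piMl// exprn_ge0.
rewrite le_eqVlt; apply/orP; left; apply/eqP.
rewrite (eq_bigr (fun=> n%:R ^+ p + m%:R * r ^+ p)); last first.
  move=> t _; rewrite big_split /= sumr_const card_ord -[r ^+ p *+ m]mulr_natl.
  rewrite (bigD1 t)//= eqxx mul1r big1 ?addr0// => l /negbTE.
  by rewrite eq_sym => ->; rewrite mul0r.
by rewrite sumr_const card_ord -mulr_natl; ring.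
Qed.

End Covariance.
Arguments hamiltonian_coef {R p n m} s tau k.

Lemma measurable_hamiltonian (R : realType) (p n m : nat) (d : measure_display)
    (T : measurableType d) (P : probability T R)
    (J : disorder_index p n m -> {RV P >-> R}) (t : 'I_m) (tau : R)
    (s : 'rV[R]_n) :
  measurable_fun setT (hamiltonian J t tau s).
Proof.
apply: measurable_funM => //; apply: measurable_sum => i.
apply: measurable_funM => //.
by apply: measurable_funD; apply: measurable_funM.
Qed.

Lemma measurable_hamiltonian_ge (R : realType) (p n m : nat)
    (d : measure_display) (T : measurableType d) (P : probability T R)
    (J : disorder_index p n m -> {RV P >-> R}) (a : R) (tau : 'I_m -> R)
    (s : 'I_m -> 'rV[R]_n) :
  measurable [set w | forall t, a <= hamiltonian J t (tau t) (s t) w].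
Proof.
rewrite [X in measurable X](_ : _ =
    \bigcap_(t in [set: 'I_m]) (hamiltonian J t (tau t) (s t) @^-1` `[a, +oo[)).
  apply: fin_bigcap_measurable => // t _.
  rewrite -[X in measurable X]setTI.
  by apply: measurable_hamiltonian.
apply/seteqP; split => w /= H t => [_|]; first by rewrite /= in_itv/= andbT.
by have := H t I; rewrite /= in_itv/= andbT.
Qed.

Lemma hamiltonian_tuple_tail (R : realType) (p n m : nat) (gamma xi : R)
    (d : measure_display) (T : measurableType d) (P : probability T R)
    (J : disorder_index p n m -> {RV P >-> R})
    (s : 'I_m -> 'rV[R]_n) (tau : 'I_m -> R) :
  (0 < m)%N -> (0 < n)%N -> 0 < gamma -> 0 < xi -> iid_std_normal J ->
  (forall t, Sigma (s t)) ->
  (forall t l, t != l -> 0 <= inner (s t) (s l) <= xi * n%:R) ->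
  (P [set w | forall t, gamma * Num.sqrt (2 * ln 2)
                 <= hamiltonian J t (tau t) (s t) w]%R
   <= (expR (- (n%:R * (ln 2 * (m%:R * gamma ^+ 2 / (1 + m%:R * xi ^+ p)))))%R)%:E)%E.
Proof.
move=> m0 n0 g0 xi0 Jnormal sS sxi.
have n0' : 0 < n%:R :> R by rewrite ltr0n.
have m0' : 0 < m%:R :> R by rewrite ltr0n.
have ln20 : 0 < ln 2 :> R by rewrite ln_gt0// ltr1n.
pose N : R := n%:R `^ (p.+1%:R / 2).
have N0 : 0 < N by exact: powR_gt0.
have NN : N ^+ 2 = n%:R ^+ p.+1.
  by rewrite /N -powR_mulrn ?powR_ge0// -powRrM divfK// powR_mulrn// ltW.
pose b := N * (m%:R * (gamma * Num.sqrt (2 * ln 2))).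
pose v : R := m%:R * n%:R ^+ p * (1 + m%:R * xi ^+ p).
have v0 : 0 < v by rewrite !mulr_gt0 ?exprn_gt0// ltr_wpDr// mulr_ge0 ?exprn_ge0// ltW.
have b0 : 0 < b by rewrite !mulr_gt0// sqrtr_gt0 mulr_gt0.
(* The variance bound with [r = xi * n%:R] is exactly [v]. *)
have av : \sum_(k : disorder_index p n m) hamiltonian_coef s tau k ^+ 2 <= v.
  apply: (le_trans (@sum_hamiltonian_coef_sqr_le _ p _ _ _ tau _ sS sxi _)).
    by rewrite mulr_ge0 ?ltW.
  by rewrite le_eqVlt; apply/orP; left; apply/eqP; rewrite /v exprMn; ring.
have := gaussian_sum_tail _ _ _ _ _ _ _ _ _ Jnormal v0 av b0.
have -> : b ^+ 2 / (2 * v) = n%:R * (ln 2 * (m%:R * gamma ^+ 2 / (1 + m%:R * xi ^+ p))).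
  rewrite /b /v !exprMn NN sqr_sqrtr ?exprS; last by rewrite mulr_ge0// ltW.
  field.
  by rewrite ?gt_eqF ?exprn_gt0//= ltr_wpDr// mulr_ge0 ?exprn_ge0// ltW.
apply: le_trans; apply: le_measure; rewrite ?inE.
- exact: measurable_hamiltonian_ge.
- exact: measurable_weighted_sum_ge.
move=> w /= wH.
have : \sum_(t < m) (gamma * Num.sqrt (2 * ln 2))
    <= \sum_t hamiltonian J t (tau t) (s t) w.
  by apply: ler_sum => t _; exact: wH.
rewrite sum_hamiltonianE sumr_const card_ord -[leLHS]mulr_natl powRN.
by rewrite -ler_pdivrMl ?invr_gt0// invrK.
Qed.

(** * Union bound *)

Lemma measure_bigcup_card_le (R : realType) (d : measure_display)
    (T : measurableType d) (P : probability T R) (Z : finType) (V : {set Z})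
    (E : Z -> set T) (b : R) :
  (forall z, measurable (E z)) -> (forall z, z \in V -> (P (E z) <= b%:E)%E) ->
  (P (\bigcup_(z in [set` V]) E z) <= (#|V|%:R * b)%:E)%E.
Proof.
move=> mE Eb.
have -> : [set` V] = [set` enum V].
  by apply/seteqP; split => z /=; rewrite mem_enum.
rewrite bigcup_seq cardE; have : {subset enum V <= V} by move=> z; rewrite mem_enum.
elim: (enum V) => [_|z s IH sV]; first by rewrite big_nil measure0 mul0r.
rewrite big_cons; apply: (le_trans (measureU2 _ _ _)) => //.
  exact: bigsetU_measurable.
rewrite /= -natr1 mulrDl mul1r addrC EFinD leeD//.
  by apply: IH => y ys; apply: sV; rewrite inE ys orbT.
by apply: Eb; apply: sV; rewrite mem_head.
Qed.

Section FirstMoment.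
Variables (R : realType) (p n m : nat) (gamma delta l : R).
Variables (d : measure_display) (T : measurableType d) (P : probability T R).
Variables (J : disorder_index p n m -> {RV P >-> R}) (I : set R).
Hypotheses (m0 : (0 < m)%N) (n0 : (0 < n)%N) (gamma0 : 0 < gamma).
Hypotheses (delta0 : 0 < delta) (delta1 : delta < 2^-1) (l0 : 0 < l).
Hypotheses (Jnormal : iid_std_normal J) (finI : finite_set I).

Let spins : finType := {ffun 'I_m -> {ffun 'I_n -> bool}}.
Let angles : finType := {ffun 'I_m -> fset_set I}.

(* Pairs of a spin tuple satisfying the overlap constraint and a tuple of
   angles. *)
Let V : {set spins * angles} := [set z : spins * angles |
  [forall t : 'I_m, forall u : 'I_m, (t < u)%N ==>
    ((1 - delta) - delta
      <= n%:R^-1 * inner (spin R (z.1 t)) (spin R (z.1 u)) <= 1 - delta)]]%SET.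

(* The event that the pair [z] is gamma-optimal. *)
Let E (z : spins * angles) : set T :=
  [set w | forall t, gamma * Num.sqrt (2 * ln 2)
     <= hamiltonian J t (val (z.2 t)) (spin R (z.1 t)) w].

Lemma Sset_nonemptyE :
  [set w | Sset J gamma (1 - delta) delta I w !=set0] = \bigcup_(z in [set` V]) E z.
Proof.
apply/seteqP; split => w.
  move=> [s [sS [tau [tauI Hge]] ov]].
  have /choice[e eE] t : exists e, s t = spin R e by exact: SigmaP.
  have tauF t : tau t \in fset_set I by rewrite in_fset_set// inE.
  exists ([ffun t => e t], [ffun t => [` tauF t]%fset]).
    rewrite /= inE; apply/forallP => t; apply/forallP => u; apply/implyP => tu.
    by rewrite !ffunE -!eE; exact: ov.
  by move=> t /=; rewrite !ffunE -eE.
move=> [[e tau]]; rewrite /= inE => /forallP ov Ew.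
exists (fun t => spin R (e t)); split => /=.
- by move=> t; exact: Sigma_spin.
- exists (fun t => val (tau t)); split; last exact: Ew.
  by move=> t; have := valP (tau t); rewrite in_fset_set// inE.
- by move=> t u tu; have /forallP/(_ u)/implyP := ov t; exact.
Qed.

Lemma card_tuples_angles_le (c : R) : #|` fset_set I|%:R <= c ->
  #|V|%:R <=
    2 ^+ n * expR (n%:R * (expR (- (2 * l)) + 2 * l * delta)) ^+ m * c ^+ m.
Proof.
move=> Ic.
pose A := [set s : spins | [forall t : 'I_m, forall u : 'I_m,
  (t < u)%N ==> ((1 - 2 * delta) * n%:R <=
        inner (spin R (s t)) (spin R (s u)))]]%SET.
have VA : V \subset finset.setX A [set: angles]%SET.
  apply/fintype.subsetP => -[s tau]; rewrite !inE /= andbT => /forallP sV.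
  apply/forallP => t; apply/forallP => u; apply/implyP => tu.
  have /forallP/(_ u)/implyP/(_ tu)/andP[+ _] := sV t.
  by rewrite mulrC ler_pdivlMr ?ltr0n//; congr (_ * _ <= _); ring.
apply: (@le_trans _ _ (#|A| * #|` fset_set I| ^ m)%:R).
  rewrite ler_nat (leq_trans (fintype.subset_leq_card VA))//.
  by rewrite cardsX cardsT card_ffun card_ord -cardfE.
rewrite natrM natrX; apply: ler_pM => //.
  exact: card_tuples_le (ltW delta0).
by apply: lerXn2r; rewrite ?nnegrE// (le_trans _ Ic).
Qed.

Lemma Sset_first_moment (c : R) : #|` fset_set I|%:R <= c ->
  (P [set w | Sset J gamma (1 - delta) delta I w !=set0] <=
   (2 ^+ n * expR (n%:R * (expR (- (2 * l)) + 2 * l * delta)) ^+ m * c ^+ m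
    * expR (- (n%:R * (ln 2 *
        (m%:R * gamma ^+ 2 / (1 + m%:R * (1 - delta) ^+ p))))))%:E)%E.
Proof.
move=> Ic; rewrite Sset_nonemptyE.
apply: (@le_trans _ _ (#|V|%:R * expR (- (n%:R * (ln 2 *
    (m%:R * gamma ^+ 2 / (1 + m%:R * (1 - delta) ^+ p))))))%:E); last first.
  by rewrite lee_fin ler_wpM2r ?expR_ge0//; exact: card_tuples_angles_le.
apply: measure_bigcup_card_le.
  by move=> z; exact: (measurable_hamiltonian_ge _ _ _ _ _ _ _ J _
    (fun t => val (z.2 t)) (fun t => spin R (z.1 t))).
move=> [s tau]; rewrite inE => /forallP sV.
have n0' : 0 < n%:R :> R by rewrite ltr0n.
have ov (t u : 'I_m) : (t < u)%N ->
    0 <= inner (spin R (s t)) (spin R (s u)) <= (1 - delta) * n%:R.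
  move=> tu; have /forallP/(_ u)/implyP/(_ tu)/= := sV t.
  rewrite mulrC ler_pdivlMr// ler_pdivrMr// => /andP[lo ->]; rewrite andbT.
  apply: le_trans lo; rewrite mulr_ge0//.
  by have := delta1; lra.
apply: (hamiltonian_tuple_tail _ _ _ _ _ _ _ _ _ J (fun t => spin R (s t))
  (fun t => val (tau t))) => //.
- by have := delta1; lra.
- by move=> t; exact: Sigma_spin.
move=> t u; rewrite neq_ltn => /orP[/ov//|/ov].
by rewrite /inner; under eq_bigr do rewrite mulrC.
Qed.

End FirstMoment.

(** * Choice of the parameters *)

(** The left-hand side is the exponential rate of the first-moment bound: entropy
    of the first spin, of the caps and of the angles, minus the Gaussian tail
    rate.  With [th = m * gamma ^ 2 - 1 > 0], the caps and the angles cost at most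
    [th * ln 2 / 8] each, while for large [p] the tail rate is at least
    [ln 2 * (1 + th / 2)]. *)
Lemma parameters_exist (R : realType) (m : nat) (gamma : R) : (0 < m)%N ->
  1 < m%:R * gamma ^+ 2 ->
  exists (delta l c C : R) (Pstar : nat),
    [/\ 0 < delta < 2^-1, 0 < l, 0 < c, 0 < C &
    forall p, (Pstar <= p)%N ->
      ln 2 + m%:R * (expR (- (2 * l)) + 2 * l * delta) + m%:R * (c * ln 2)
        - ln 2 * (m%:R * gamma ^+ 2 / (1 + m%:R * (1 - delta) ^+ p)) <= - C].
Proof.
move=> m0 mg; pose th : R := m%:R * gamma ^+ 2 - 1.
have th0 : 0 < th by rewrite subr_gt0.
have m0' : 0 < m%:R :> R by rewrite ltr0n.
have ln20 : 0 < ln 2 :> R by rewrite ln_gt0// ltr1n.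
pose k : R := th * ln 2 / (8 * m%:R).
have k0 : 0 < k by rewrite !(mulr_gt0, invr_gt0).
(* [k^-1] makes [expR (- (2 * l))] at most [k / 2]; [k] and 1 keep [delta]
   below 1/2. *)
pose l : R := 1 + k + k^-1.
have l0 : 0 < l by rewrite !addr_gt0 ?invr_gt0.
pose delta : R := k / (4 * l).
have delta0 : 0 < delta by rewrite !(mulr_gt0, invr_gt0).
have delta1 : delta < 2^-1.
  rewrite /delta ltr_pdivrMr ?mulr_gt0//.
  have : 0 < k^-1 by rewrite invr_gt0.
  by rewrite /l; lra.
have lk : expR (- (2 * l)) + 2 * l * delta <= k.
  have -> : 2 * l * delta = k / 2 by rewrite /delta; field; rewrite gt_eqF.
  suff : expR (- (2 * l)) <= k / 2 by lra.
  have k20 : 0 < k / 2 by lra.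
  rewrite expRN -[leRHS]invrK lef_pV2 ?posrE ?expR_gt0 ?invr_gt0//.
  apply: le_trans (expR_ge1Dx _); rewrite invf_div /l.
  have : 0 < k^-1 by rewrite invr_gt0.
  by lra.
(* [rho] solves [(1 + th) / (1 + rho) = 1 + th / 2]. *)
pose rho : R := (th / 2) / (1 + th / 2).
have rho0 : 0 < rho by rewrite divr_gt0//; lra.
have delta1' : 0 <= 1 - delta by lra.
have [Pstar _ PstarP] : \forall p \near \oo, m%:R * (1 - delta) ^+ p <= rho.
  have xin : `|1 - delta| < 1 by rewrite ger0_norm; lra.
  have /cvgrPdist_le/(_ (rho / m%:R)) := cvg_expr xin.
  rewrite divr_gt0// => /(_ isT); apply: filterS => p.
  rewrite sub0r normrN ger0_norm ?exprn_ge0//.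
  by rewrite ler_pdivlMr// mulrC.
exists delta, l, (th / (8 * m%:R)), (th * ln 2 / 4), Pstar; split.
- by rewrite delta0.
- exact: l0.
- by rewrite divr_gt0// mulr_gt0.
- by rewrite divr_gt0// mulr_gt0.
move=> p /PstarP /= mr.
have x0 : 0 <= m%:R * (1 - delta) ^+ p by rewrite mulr_ge0// exprn_ge0.
have ratio : 1 + th / 2 <= m%:R * gamma ^+ 2 / (1 + m%:R * (1 - delta) ^+ p).
  rewrite ler_pdivlMr; last by lra.
  have -> : m%:R * gamma ^+ 2 = (1 + th / 2) * (1 + rho).
    have -> : m%:R * gamma ^+ 2 = 1 + th by rewrite /th; ring.
    by rewrite /rho; field; rewrite gt_eqF//; lra.
  by rewrite ler_wpM2l ?lerD2l//; lra.
have H1 : m%:R * (expR (- (2 * l)) + 2 * l * delta) <= th * ln 2 / 8.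
  have -> : th * ln 2 / 8 = m%:R * k by rewrite /k; field; rewrite gt_eqF.
  by rewrite ler_wpM2l.
have H2 : m%:R * (th / (8 * m%:R) * ln 2) = th * ln 2 / 8.
  by field; rewrite gt_eqF.
have H3 := ler_wpM2l (ltW ln20) ratio.
have H4 : ln 2 * (1 + th / 2) = ln 2 + th * ln 2 / 2 by ring.
rewrite H2; lra.
Qed.

Theorem theorem2p11 (R : realType) (m : nat) (gamma : R) :
  (0 < m)%N -> 0 < gamma < 1 -> (Num.sqrt m%:R)^-1 < gamma ->
  exists (eta xi c : R) (Pstar : nat),
    [/\ 0 < eta, eta < xi, xi < 1, 0 < c &
      forall (p : nat) (I : nat -> set R), (2 <= p)%N -> (Pstar <= p)%N ->
        (forall n, (0 < n)%N ->
          [/\ I n `<=` `[0, pi / 2], finite_set (I n) &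
              #|` fset_set (I n)|%:R <= 2 `^ (c * n%:R)]) ->
      forall (d : nat -> measure_display)
        (T : forall n, measurableType (d n))
        (P : forall n, probability (T n) R)
        (J : forall n, disorder_index p n m -> {RV (P n) >-> R}),
        (forall n, (0 < n)%N -> iid_std_normal (J n)) ->
      exists2 C : R, 0 < C &
        \forall n \near \oo,
          (P n [set w | Sset (J n) gamma xi eta (I n) w !=set0]
             <= (expR (- (C * n%:R)))%:E)%E].
Proof.
move=> m0 /andP[gamma0 _] gammam.
have m0' : 0 < m%:R :> R by rewrite ltr0n.
have mg : 1 < m%:R * gamma ^+ 2.
  have s0 : 0 < Num.sqrt m%:R :> R by rewrite sqrtr_gt0.
  have sg : 1 < Num.sqrt m%:R * gamma by rewrite mulrC -ltr_pdivrMr// div1r.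
  by rewrite -[m%:R]sqr_sqrtr ?ltW// -exprMn exprn_egt1.
have [delta [l [c [C [Pstar [/andP[delta0 delta1] l0 c0 C0 PstarP]]]]]] :=
  parameters_exist _ _ _ m0 mg.
exists delta, (1 - delta), c, Pstar; split => //; try lra.
move=> p I _ /PstarP exponent HI d T P J Jnormal.
exists C => //; exists 1%N => // n /= n0.
have [_ finI cardI] := HI n n0.
apply: (le_trans (Sset_first_moment _ _ _ _ _ _ _ _ _ _ _ _ m0 n0 gamma0
  delta0 delta1 l0 (Jnormal n n0) finI _ cardI)).
rewrite lee_fin.
have two : 2 = expR (ln 2) :> R by rewrite lnK// posrE.
rewrite /powR ifF; last by rewrite pnatr_eq0.
rewrite {1}two -!expRM_natl -!expRD ler_expR.
apply: le_trans (_ : n%:R * - C <= _); last by rewrite mulrN mulrC.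
apply: le_trans (ler_wpM2l (ler0n _ n) exponent).
by rewrite le_eqVlt; apply/orP; left; apply/eqP; ring.
Qed.
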